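(* Let $f$ be a ReLU network, $\mathcal{X}\subset\mathbb{R}^{n_0}$ an open set expressible by quadratic or linear constraints, and $\varepsilon\ge0$. The problem $(\underline{\mathcal{P}}_2)_\varepsilon$ defined in the context is equivalent to the problem $$\begin{array}{ll}\displaystyle\max_{y,\sigma,x}&\|y_L\|_2^2\\ \text{s.t.}& y_k=M_k\,\mathrm{diag}(\sigma_{k-1})\,y_{k-1},\quad k=2,\dots,L,\\ & y_1=M_1y_0,\\ & x_k=\sigma_k\odot(M_kx_{k-1}+b_k),\quad k=1,\dots,L-1,\\ & (\sigma_k-\tfrac12)\odot(M_kx_{k-1}+b_k)\ge\varepsilon,\quad k=1,\dots,L-1,\\ & \sigma_k\in\{0,1\}^{n_k},\quad k=1,\dots,L-1,\\ & x_0\in\mathcal{X},\\ & \|y_0\|_2^2\le1,\end{array}$$ in the sense that the two problems have the same feasible set and the same optimal solutions, and, when feasible, the optimal value of the displayed problem is the square of that of $(\underline{\mathcal{P}}_2)_\varepsilon$.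
   Context: Network data: $f:\mathbb{R}^{n_0}\to\mathbb{R}^{n_L}$, $f=T_L\circ\rho_{L-1}\circ T_{L-1}\circ\cdots\circ\rho_1\circ T_1$, where $T_k(x)=M_kx+b_k$ maps $\mathbb{R}^{n_{k-1}}$ to $\mathbb{R}^{n_k}$ and $\rho_k$ applies $\mathrm{ReLU}(t)=\max(t,0)$ componentwise. Problem $(\underline{\mathcal{P}}_2)_\varepsilon$: maximize $\|y_L\|_2$ over $y=(y_0,\dots,y_L)$, $\sigma=(\sigma_1,\dots,\sigma_{L-1})$, $x=(x_0,\dots,x_{L-1})$ with $y_k,x_k\in\mathbb{R}^{n_k}$, subject to: $y_k=M_k\,\mathrm{diag}(\sigma_{k-1})y_{k-1}$ for $k=2,\dots,L$; $y_1=M_1y_0$; $x_k=\sigma_k\odot(M_kx_{k-1}+b_k)$, $(\sigma_k-\tfrac12)\odot(M_kx_{k-1}+b_k)\ge\varepsilon$ and $\sigma_k\in\{0,1\}^{n_k}$ for $k=1,\dots,L-1$; $x_0\in\mathcal{X}$; $\|y_0\|_2\le1$. $\odot$ is the Hadamard (componentwise) product; $\sigma_k-\tfrac12$ subtracts $\tfrac12$ from each component; vector inequalities are componentwise. *)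

(* Defs.v *)
From mathcomp Require Import all_boot all_order all_algebra.
From mathcomp Require Import all_classical all_reals all_analysis.
Set Implicit Arguments.
Unset Strict Implicit.
Unset Printing Implicit Defensive.
Import Order.TTheory GRing.Theory Num.Theory.
Import numFieldNormedType.Exports.
Local Open Scope classical_set_scope.
Local Open Scope ring_scope.

(** Indexing.  A network has [L = l.+1] layers, [l] being the number of hidden
    layers, and widths [n 0, ..., n L]; the values of [n] beyond [L] are never
    used.  Families indexed from 1 on paper are shifted to start at 0:
    - [weight f k], [bias f k] for [k : 'I_l.+1] are M_(k+1), b_(k+1);
    - [pt_sigma z k] for [k : 'I_l] is sigma_(k+1);
    - [pt_y z k] for [k : 'I_l.+2] is y_k, and [pt_x z k] for [k : 'I_l.+1]
      is x_k.
    The ordinals below have values [k] and [k.+1] up to conversion, so that the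
    dimensions match without casts. *)
Notation same k := (widen_ord (leqnSn _) k).
Notation next k := (lift ord0 k).

Section Vectors.
Variable R : realType.

(** The library norm on matrices is the sup norm, hence this definition. *)
Definition norm2 (m : nat) (v : 'cV[R]_m) : R :=
  Num.sqrt (\sum_i v i 0 ^+ 2).

Definition hadamard (m : nat) (u v : 'cV[R]_m) : 'cV[R]_m := map2_mx *%R u v.

Definition diag (m : nat) (s : 'cV[R]_m) : 'M[R]_m := diag_mx s^T.

Definition relu (t : R) : R := Num.max t 0.

Definition quad_fun (m : nat) (A : 'M[R]_m) (c : 'cV[R]_m) (d : R)
    (x : 'cV[R]_m) : R :=
  (x^T *m A *m x) 0 0 + (c^T *m x) 0 0 + d.

(** Solution sets of finite systems of constraints [q x <= 0] or [q x < 0]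
    ([large i] selects the non-strict form), with [q] a polynomial of degree at
    most 2.  A linear constraint has [A i = 0]; an equality is a pair of
    non-strict inequalities. *)
Definition quadratically_expressible (m : nat) (X : set 'cV[R]_m) : Prop :=
  exists (p : nat) (A : 'I_p -> 'M[R]_m) (c : 'I_p -> 'cV[R]_m)
    (d : 'I_p -> R) (large : 'I_p -> bool),
    X = [set x | forall i, quad_fun (A i) (c i) (d i) x < 0 ?<= if large i].

End Vectors.

Section Network.
Variables (R : realType) (l : nat) (n : nat -> nat).

Record relu_network := ReluNetwork {
  weight : forall k : 'I_l.+1, 'M[R]_(n k.+1, n k);
  bias : forall k : 'I_l.+1, 'cV[R]_(n k.+1) }.

Variable f : relu_network.

Definition affine (k : 'I_l.+1) (v : 'cV[R]_(n k)) : 'cV[R]_(n k.+1) :=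
  weight f k *m v + bias f k.

Fixpoint hidden (k : nat) : (k < l.+1)%N -> 'cV[R]_(n 0%N) -> 'cV[R]_(n k) :=
  match k with
  | 0 => fun _ v => v
  | k'.+1 => fun lt_k v =>
      map_mx (@relu R) (@affine (Ordinal (ltnW lt_k)) (hidden (ltnW lt_k) v))
  end.

Definition network_fun (v : 'cV[R]_(n 0%N)) : 'cV[R]_(n l.+1) :=
  @affine ord_max (hidden (ltnSn l) v).

End Network.

Coercion network_fun : relu_network >-> Funclass.

(** Maximization problems.  The optimal value is the supremum of the objective
    over the feasible set, in the extended reals ([-oo] if infeasible); when an
    optimal solution exists it is the maximum. *)
Record max_problem (R : realType) (T : Type) := MaxProblem {
  objective : T -> R;
  feasible : set T }.

Definition optimal_solutions (R : realType) (T : Type)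
    (P : max_problem R T) : set T :=
  [set z | feasible P z /\
           forall w, feasible P w -> objective P w <= objective P z].

Definition optimal_value (R : realType) (T : Type) (P : max_problem R T)
    : \bar R :=
  ereal_sup [set (objective P z)%:E | z in feasible P].

Section Problems.
Variables (R : realType) (l : nat) (n : nat -> nat).

Record point := Point {
  pt_y : forall k : 'I_l.+2, 'cV[R]_(n k);
  pt_sigma : forall k : 'I_l, 'cV[R]_(n k.+1);
  pt_x : forall k : 'I_l.+1, 'cV[R]_(n k) }.

Variables (f : relu_network R l n) (X : set 'cV[R]_(n 0%N)) (eps : R).

(** M_k x_(k-1) + b_k for a hidden layer. *)
Definition preact (z : point) (k : 'I_l) : 'cV[R]_(n k.+1) :=
  affine f (pt_x z (same k)).

(** All the constraints shared by the two problems, i.e. all but the bound on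
    y_0; the first one is for layers 2, ..., L. *)
Definition common_constraints (z : point) : Prop :=
  let y := pt_y z in let sigma := pt_sigma z in let x := pt_x z in
  [/\ forall k : 'I_l, y (next (next k)) =
        weight f (next k) *m diag (sigma k) *m y (next (same k)),
      y (next ord0) = weight f ord0 *m y ord0,
      forall k : 'I_l, x (next k) = hadamard (sigma k) (preact z k),
      forall (k : 'I_l) (i : 'I_(n k.+1)),
        eps <= hadamard (sigma k - const_mx 2^-1) (preact z k) i 0 &
      (forall (k : 'I_l) (i : 'I_(n k.+1)),
        sigma k i 0 = 0 \/ sigma k i 0 = 1) /\ X (x ord0)].

Definition problem_P2 : max_problem R point :=
  {| objective := fun z => norm2 (pt_y z ord_max);
     feasible := [set z | common_constraints z /\ norm2 (pt_y z ord0) <= 1] |}.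

Definition problem_P2_squared : max_problem R point :=
  {| objective := fun z => norm2 (pt_y z ord_max) ^+ 2;
     feasible :=
       [set z | common_constraints z /\ norm2 (pt_y z ord0) ^+ 2 <= 1] |}.

End Problems.

(* Main.v *)
Require Import Defs.
From mathcomp Require Import all_boot all_order all_algebra.
From mathcomp Require Import all_classical all_reals all_analysis.
Import Order.TTheory GRing.Theory Num.Theory.
Import numFieldNormedType.Exports.
Local Open Scope classical_set_scope.
Local Open Scope ring_scope.

(** Squaring is an increasing bijection of the nonnegative reals onto
    themselves, and the Euclidean norm is nonnegative.  Hence bounding the norm
    of y_0 by 1 or its square by 1 is the same constraint, and comparing two
    feasible points by the norm of y_L or by its square gives the same order, so
    the same maximizers.  For the optimal values, which need not be attained nor
    finite, the point is that squaring commutes with suprema of nonempty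
    families of nonnegative reals ([ereal_sup_sqr]): square roots turn an upper
    bound of the squares into an upper bound of the family. *)

Lemma norm2_ge0 (R : realType) (m : nat) (v : 'cV[R]_m) : 0 <= norm2 v.
Proof. exact: sqrtr_ge0. Qed.

(** Every [h z ^+ 2] is at most the square of the supremum.  Conversely, if the
    supremum of the squares is a real [r], then [h z] is at most the square root
    of [r] for all [z], hence so is the supremum; if it is infinite, it is [+oo]
    by nonemptiness and nothing is left to prove.  On the empty family the two
    sides would be [-oo] and [+oo]. *)
Lemma ereal_sup_sqr (R : realType) (T : Type) (D : set T) (h : T -> R) :
  (forall z, 0 <= h z) -> D !=set0 ->
  ereal_sup [set (h z ^+ 2)%:E | z in D] =
  (ereal_sup [set (h z)%:E | z in D] ^+ 2)%E.
Proof.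
move=> h_ge0 [z0 Dz0].
set q := ereal_sup [set (h z ^+ 2)%:E | z in D].
set s := ereal_sup [set (h z)%:E | z in D].
have le_s z : D z -> ((h z)%:E <= s)%E.
  by move=> Dz; apply: ereal_sup_ubound; exists z.
have le_q z : D z -> ((h z ^+ 2)%:E <= q)%E.
  by move=> Dz; apply: ereal_sup_ubound; exists z.
have s_ge0 : (0 <= s)%E.
  by apply: le_trans (le_s _ Dz0); rewrite lee_fin.
apply/le_anti/andP; split.
  apply: ge_ereal_sup => _ [z Dz <-].
  by rewrite EFin_expe !expe2; apply: lee_pmul; rewrite ?lee_fin ?le_s.
have : (0 <= q)%E.
  by apply: le_trans (le_q _ Dz0); rewrite lee_fin sqr_ge0.
case: q le_q => [r | |] // le_q; last by move=> _; apply: leey.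
rewrite lee_fin => r_ge0.
have s_le : (s <= (Num.sqrt r)%:E)%E.
  apply: ge_ereal_sup => _ [z Dz <-].
  by rewrite lee_fin -[leLHS]ger0_norm // -sqrtr_sqr ler_wsqrtr // -lee_fin le_q.
rewrite -(sqr_sqrtr r_ge0) EFin_expe !expe2.
exact: lee_pmul.
Qed.

Theorem mainTheorem4 (R : realType) (l : nat) (n : nat -> nat)
    (f : relu_network R l n) (X : set 'cV[R]_(n 0%N)) (eps : R)
    (X_open : open X) (X_quad : quadratically_expressible X)
    (eps_ge0 : 0 <= eps) :
  let P := problem_P2 f X eps in
  let Q := problem_P2_squared f X eps in
  [/\ feasible P = feasible Q,
      optimal_solutions P = optimal_solutions Q &
      feasible P !=set0 -> optimal_value Q = (optimal_value P ^+ 2)%E].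
Proof.
move=> P Q.
have eq_feas : feasible P = feasible Q.
  apply/seteqP; split=> z /= [zC y0_le1]; split=> //; move: y0_le1;
    by rewrite expr_le1 // norm2_ge0.
split=> // [|feas_P].
  rewrite /optimal_solutions -eq_feas.
  by apply/seteqP; split=> z /= [Pz z_max]; split=> // w /z_max;
    rewrite ler_sqr // nnegrE norm2_ge0.
rewrite /optimal_value -eq_feas /=.
by apply: ereal_sup_sqr => // z; apply: norm2_ge0.
Qed.
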